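(* Let $k$ be a positive integer and let $G$ be a finite simple graph containing no cycle of even length at most $2k$. Let $u,v$ be distinct vertices of $G$ and let $\mathcal{P}_k(u,v)$ denote the set of $uv$-paths in $G$ of length exactly $k$. Then \[ |\mathcal{P}_k(u,v)| \;\leq\; \max\left\{ \binom{r}{m} \;:\; r\in\{0,1,\dots,k\},\ m = \min\left\{\left\lfloor \tfrac{r}{2}\right\rfloor,\, k-r\right\}\right\}. \]
   Context: The length of a path is its number of edges. *)

(* Defs.v *)
From mathcomp Require Import all_boot.

Set Implicit Arguments.
Unset Strict Implicit.
Unset Printing Implicit Defensive.

(* A finite simple graph is a symmetric irreflexive relation e on a finType. *)

(* [ucycleb] also accepts sequences of size 0 and, for a symmetric e, of
   size 2 (an edge traversed back and forth); the size bound excludes them.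
   The length of the cycle is [size c]. *)
Definition graph_cycle (T : finType) (e : rel T) (c : seq T) : bool :=
  (2 < size c) && ucycleb e c.

(* A uv-path of length k is encoded by its k vertices following u, in order
   from u to v. For u != v this encoding is one-to-one, also when paths are
   regarded as subgraphs, since the direction is fixed by the endpoints. *)
Definition upaths (T : finType) (e : rel T) (k : nat) (u v : T) :
    {set k.-tuple T} :=
  [set p : k.-tuple T | [&& path e u p, uniq (u :: p) & last u p == v]].

(* Main.v *)
Require Import Defs.
From mathcomp Require Import all_boot.
From mathcomp Require Import zify.

Set Implicit Arguments.
Unset Strict Implicit.
Unset Printing Implicit Defensive.

(* Fix a shortest walk Y from u to v, of length n.  A path X of length k from u
   to v decomposes along Y into edges of Y and ears which, together with the
   segments of Y they replace, form odd cycles; since Y is shortest, every ear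
   is longer than its segment.  Two ears with the same starting vertex coincide,
   for otherwise they and Y would contain a theta graph, hence an even cycle,
   with at most 2k edges.  So X is determined by the set of starting vertices of
   its ears, and a larger set gives a longer path: these sets form an antichain
   of subsets of an n-element set, of size at most k - n, and the LYM inequality
   bounds their number by 'C(n, minn (n %/ 2) (k - n)). *)

(** * Antichains *)

Lemma leq_bin2l_half n i j : i <= j -> j <= n %/ 2 -> 'C(n, i) <= 'C(n, j).
Proof.
elim: j => [|j IHj]; first by rewrite leqn0 => /eqP->.
rewrite leq_eqVlt => /predU1P[-> //|i_le_j] j_half.
apply: leq_trans (IHj _ _) _; [lia | lia |].
(* Here [j.+1 * 'C(n, j.+1) = (n - j) * 'C(n, j)], and [j.+1 <= n - j] up to the middle. *)
rewrite -(leq_pmul2l (ltn0Sn j)) mul_bin_left leq_mul2r; lia.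
Qed.

Lemma leq_bin_minn_half n m a :
  a <= n -> a <= m -> 'C(n, a) <= 'C(n, minn (n %/ 2) m).
Proof.
move=> a_le_n a_le_m; case: (leqP a (n %/ 2)) => a_half.
  by apply: leq_bin2l_half; rewrite ?geq_minl // leq_min a_half.
(* Above the middle, reflect to [n - a], which is at most [a] and hence at most [m]. *)
rewrite -bin_sub //; apply: leq_bin2l_half; last exact: geq_minl.
rewrite leq_min; lia.
Qed.

(* The LYM inequality, cleared of denominators: averaging over the members
   avoiding a given element reduces it to a smaller ground set. *)
Lemma LYM_fact (T : finType) (D : {set T}) (F : {set {set T}}) :
    {in F, forall A : {set T}, A \subset D} ->
    {in F &, forall A B : {set T}, A \subset B -> A = B} ->
  \sum_(A in F) #|A|`! * (#|D| - #|A|)`! <= #|D|`!.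
Proof.
move En : #|D| => n; elim: n D En F => [|n IHn] D En F sFD antiF.
  have D0 : D = set0 by apply/eqP; rewrite -cards_eq0 En.
  have /subset_leq_card : F \subset [set set0].
    by apply/subsetP=> A /sFD; rewrite D0 subset0 inE.
  rewrite cards1 => F1; rewrite (eq_bigr (fun=> 1)) ?sum1_card // => A /sFD.
  by rewrite D0 subset0 => /eqP ->; rewrite cards0.
(* If [D] belongs to [F], it is the only member. *)
case: (boolP (D \in F)) => [DF|nDF].
  rewrite (bigD1 D) //= big1 ?addn0 ?En ?subnn ?fact0 ?muln1 // => A /andP[AF].
  by case/eqP; apply: antiF => //; apply: sFD.
have ltF A : A \in F -> #|A| <= n.
  move=> AF; rewrite -ltnS -En; apply: proper_card.
  rewrite properEneq sFD // andbT.
  by apply: contraNneq nDF => <-.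
have -> : n.+1`! = \sum_(x in D) n`! by rewrite sum_nat_const En factS.
(* The weight of [A] is shared equally among the elements of [D] outside [A]; each share is the
   weight of [A] in a ground set of size [n]. *)
rewrite (eq_bigr (fun A : {set T} =>
  \sum_(x in D | x \notin A) #|A|`! * (n - #|A|)`!)); last first.
  move=> A AF; rewrite (eq_bigl [in D :\: A]); last first.
    by move=> x; rewrite !inE andbC.
  rewrite sum_nat_const cardsD (setIidPr (sFD _ AF)) En.
  by rewrite (subSn (ltF _ AF)) factS mulnCA.
rewrite (exchange_big_dep [in D]) /=; last by move=> A x _ /andP[].
apply: leq_sum => x xD.
rewrite (eq_bigl [in [set A in F | x \notin A]]); last first.
  by move=> A; rewrite !inE xD.
apply: (IHn (D :\ x)).
- by move: En; rewrite (cardsD1 x) xD => -[].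
- by move=> A; rewrite inE => /andP[/sFD sAD xA]; rewrite subsetD1 sAD.
- by move=> A B; rewrite !inE => /andP[AF _] /andP[BF _]; apply: antiF.
Qed.

(** Each term of the LYM sum is the factorial of [#|D|] divided by ['C(#|D|, #|A|)], and this
    coefficient is at most the stated one because [#|A| <= m]. *)
Lemma card_antichain_le (T : finType) (D : {set T}) (F : {set {set T}}) m :
    {in F, forall A : {set T}, A \subset D} ->
    {in F &, forall A B : {set T}, A \subset B -> A = B} ->
    {in F, forall A : {set T}, #|A| <= m} ->
  #|F| <= 'C(#|D|, minn (#|D| %/ 2) m).
Proof.
move=> sFD antiF leFm; set M := 'C(_, _).
rewrite -(leq_pmul2r (fact_gt0 #|D|)) -sum_nat_const.
apply: leq_trans (leq_mul (leqnn M) (LYM_fact sFD antiF)).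
rewrite big_distrr; apply: leq_sum => A AF /=.
have AD := subset_leq_card (sFD _ AF).
rewrite -(bin_fact AD) leq_mul2r; apply/orP; right.
exact: leq_bin_minn_half (leFm _ AF).
Qed.

(** * Sequences *)

Lemma has_split_first (T : eqType) (p : pred T) (s : seq T) :
  has p s -> exists s1 y s2, [/\ s = s1 ++ y :: s2, p y & ~~ has p s1].
Proof.
elim: s => //= x s IHs; have [px _|npx /=] := boolP (p x).
  by exists [::], x, s.
case/IHs=> s1 [y [s2 [-> py ns1]]].
by exists (x :: s1), y, s2; rewrite /= (negPf npx).
Qed.

Lemma mem_split (T : eqType) (x : T) s :
  x \in s -> exists s1 s2, s = s1 ++ x :: s2.
Proof. by case/splitPr => s1 s2; exists s1, s2. Qed.

(** Otherwise [y], at position [size s3], would fall inside [s1]. *)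
Lemma leq_size_disjoint_prefix (T : eqType) (s1 s2 s3 s4 : seq T) x y :
    s1 ++ x :: s2 = s3 ++ y :: s4 -> y \notin s1 -> size s1 <= size s3.
Proof.
move=> E ys1; rewrite leqNgt; apply: contra ys1 => lt31.
have := congr1 (fun s => nth x s (size s3)) E.
by rewrite /= !nth_cat lt31 ltnn subnn /= => <-; apply: mem_nth.
Qed.

(** * Paths in graphs without short even cycles *)

Section Graph.

Variables (k : nat) (T : finType) (e : rel T).
Hypothesis e_sym : symmetric e.
Hypothesis no_short_even_cycle :
  ~ exists c : seq T, [/\ graph_cycle e c, ~~ odd (size c) & size c <= 2 * k].

(** The two paths close up to a cycle of length [size X + size Y + 2], which cannot be even. Were
    [X] and [Y] both empty, it would be a single edge traversed twice. *)
Lemma odd_internally_disjoint x y X Y :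
    path e x (rcons X y) -> path e x (rcons Y y) ->
    uniq (x :: rcons X y) -> uniq (x :: rcons Y y) -> ~~ has [in X] Y ->
    0 < size X + size Y -> size X + size Y + 2 <= 2 * k ->
  odd (size X + size Y).
Proof.
move=> pX pY uX uY dXY gt0 le2k; apply: contraPT no_short_even_cycle => ev.
apply; exists (x :: X ++ y :: rev Y).
have Es : size (x :: X ++ y :: rev Y) = size X + size Y + 2.
  by rewrite /= size_cat /= size_rev; lia.
rewrite Es; split; [|lia|exact: le2k].
rewrite /graph_cycle Es; apply/andP; split; first lia.
apply/andP; split.
  rewrite /= rcons_cat cat_path; move: pX; rewrite rcons_path => /andP[-> pXy].
  rewrite /= pXy /=; have := rev_path e x (rcons Y y).
  rewrite last_rcons belast_rcons rev_cons => ->.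
  by rewrite (eq_path (e' := e)) // => a b; rewrite /= e_sym.
move: uX uY; rewrite /= !mem_rcons !rcons_uniq !inE !negb_or.
case/andP=> /andP[xy xX] /andP[yX uX] /andP[/andP[_ xY] /andP[yY uY]].
rewrite mem_cat inE mem_rev !negb_or xX xy xY /=.
rewrite cat_uniq uX /= mem_rev yY rev_uniq uY !andbT negb_or yX /=.
by rewrite (eq_has_r (mem_rev Y)).
Qed.

(* Splice the shorter side of the first odd cycle formed by X and Y into the
   other path. If neither splice shortens, then the first vertex of X on Y and
   the first vertex of Y on X occur in incompatible orders. *)
Lemma opposite_parity_path x X Y :
    path e x X -> path e x Y -> uniq (x :: X) -> uniq (x :: Y) ->
    last x X = last x Y -> size X + size Y <= 2 * k ->
    ~~ odd (size X + size Y) -> X <> Y ->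
  exists Z, [/\ path e x Z, uniq (x :: Z) & last x Z = last x X] /\
    [/\ odd (size Z + size X), size Z < maxn (size X) (size Y),
        {subset Z <= X ++ Y} & head x Z \in [:: head x X; head x Y]].
Proof.
elim: X x Y => [|a X IH] x [|b Y] //.
- move=> _ _ _ /= /andP[xY _] E; case/negP: xY.
  by rewrite [X in X \in _]E mem_last.
- move=> _ _ /= /andP[xX _] _ E; case/negP: xX.
  by rewrite -[X in X \in _]E mem_last.
have [<-|neq_ab] := eqVneq a b.
  move=> /= /andP[ea pX] /andP[_ pY] /andP[xX uX] /andP[xY uY] El le ev neq.
  have [|||Z [[pZ uZ lZ] [oZ ltZ sZ _]]] := IH a Y pX pY uX uY El.
  - by move: le; clear; lia.
  - by move: ev; clear; lia.
  - by move=> E; apply: neq; rewrite E.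
  exists (a :: Z); split; split=> //=.
  - by rewrite ea.
  - move: uZ => /= ->; rewrite andbT; move: xX xY; rewrite !inE !negb_or.
    case/andP=> -> xX /andP[_ xY] /=; apply/negP=> /sZ; rewrite mem_cat.
    by rewrite (negPf xX) (negPf xY).
  - by rewrite addnS /= negbK.
  - by rewrite maxnSS ltnS.
  - move=> z; rewrite !inE mem_cat inE => /predU1P[->|/sZ]; first by rewrite eqxx.
    by rewrite mem_cat => /orP[->|->]; rewrite !orbT.
  - by rewrite inE eqxx.
(* The first vertex of [X] on [Y] is [q]; the spliced path follows [X] up to [q] and then [Y]. The
   claim is general in [X] and [Y] so that their roles can be exchanged. *)
have {IH} splice : forall X Y, path e x X -> path e x Y ->
    uniq (x :: X) -> uniq (x :: Y) ->
    last x X = last x Y -> size X + size Y <= 2 * k ->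
    ~~ odd (size X + size Y) -> head x X != head x Y -> X != [::] ->
    exists X1 q X2 Y1 Y2, [/\ X = X1 ++ q :: X2, Y = Y1 ++ q :: Y2,
       ~~ has [in Y] X1, odd (size X1 + size Y1) &
    (size X1 < size Y1) -> 
    exists Z, [/\ path e x Z, uniq (x :: Z) & last x Z = last x X] /\
    [/\ odd (size Z + size X), size Z < maxn (size X) (size Y),
        {subset Z <= X ++ Y} & head x Z \in [:: head x X; head x Y]]].
  move=> {IH a b neq_ab} {}X {}Y pX pY uX uY El le ev neq nX.
  have lX : last x X \in X.
    by case: (X) nX => //= c s _; apply: mem_last.
  have lY : last x X \in Y.
    move: uX; rewrite El; case: (Y) El => /= [|c s _ _]; last exact: mem_last.
    by move: lX => /[swap] -> ->.
  have /has_split_first[X1 [q [X2 [EX qY dX]]]] : has [in Y] X.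
    by apply/hasP; exists (last x X).
  have [Y1 [Y2 EY]] := mem_split qY.
  exists X1, q, X2, Y1, Y2.
  have oXY : odd (size X1 + size Y1).
    apply: (@odd_internally_disjoint x q).
    - by move: pX; rewrite EX -cat_rcons cat_path => /andP[].
    - by move: pY; rewrite EY -cat_rcons cat_path => /andP[].
    - by move: uX; rewrite EX -cat_rcons -cat_cons cat_uniq => /and3P[].
    - by move: uY; rewrite EY -cat_rcons -cat_cons cat_uniq => /and3P[].
    - apply: contra dX => /hasP[z zY1 zX1]; apply/hasP; exists z => //=.
      by rewrite EY mem_cat zY1.
    - rewrite lt0n addn_eq0; apply/negP=> /andP[/nilP X10 /nilP Y10].
      by move: neq; rewrite EX EY X10 Y10 eqxx.
    - by move: le; rewrite EX EY !size_cat /=; clear; lia.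
  split=> // lt; exists (X1 ++ q :: Y2); split; split.
  - move: pX pY; rewrite EX EY -!cat_rcons !cat_path !last_rcons.
    by case/andP=> -> _ /andP[].
  - move: uX uY dX; rewrite EX EY /= !mem_cat !inE !negb_or !cat_uniq /=.
    case/andP=> /and3P[xX1 xq _] /and3P[uX1 _ _].
    case/andP=> /and3P[_ _ xY2] /and3P[_ _ uqY2] dX.
    rewrite xX1 xq xY2 uX1 uqY2 /= andbT -/(has _ (q :: Y2)).
    apply: contra dX => /hasP[z zY zX]; apply/hasP; exists z => //=.
    by rewrite mem_cat zY orbT.
  - by rewrite El EY !last_cat.
  - by move: oXY ev; rewrite EX EY !size_cat /=; clear; lia.
  - by move: lt; rewrite EX EY !size_cat /=; clear; lia.
  - move=> z; rewrite EX EY !mem_cat !inE.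
    by case/or3P=> ->; rewrite ?orbT.
  - rewrite EX; case: (X1) => [|c s] /=; by rewrite inE eqxx.
move=> pX pY uX uY El le ev _.
have [||X1 [q [X2 [Y1 [Y2 [EX EY dX oX hX]]]]]] := splice _ _ pX pY uX uY El le ev.
- exact: neq_ab.
- by [].
have [||||Y3 [r [Y4 [X3 [X4 [EY' EX' dY oY hY]]]]]] :=
  splice _ _ pY pX uY uX (esym El).
- by rewrite addnC.
- by rewrite addnC.
- by rewrite eq_sym.
- by [].
case: (ltnP (size X1) (size Y1)) => [/hX //|le1].
case: (ltnP (size Y3) (size X3)) => [/hY|le3].
  case=> Z [[pZ uZ lZ] [oZ ltZ sZ hZ]]; exists Z; split; split=> //.
  - by rewrite lZ El.
  - by move: oZ ev; clear; lia.
  - by rewrite maxnC.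
  - by move=> z /sZ; rewrite !mem_cat orbC.
  - by move: hZ; rewrite !inE orbC.
have leX : size X1 <= size X3.
  have E : X1 ++ q :: X2 = X3 ++ r :: X4 by rewrite -EX -EX'.
  apply: (leq_size_disjoint_prefix E); apply: contra dX => rX1.
  by apply/hasP; exists r => //=; rewrite EY' mem_cat mem_head orbT.
have leY : size Y3 <= size Y1.
  have E : Y3 ++ r :: Y4 = Y1 ++ q :: Y2 by rewrite -EY -EY'.
  apply: (leq_size_disjoint_prefix E); apply: contra dY => qY3.
  by apply/hasP; exists q => //=; rewrite EX mem_cat mem_head orbT.
(* The inequalities form a cycle [size Y1 <= size X1 <= size X3 <= size Y3 <= size Y1], so
   [size X1 + size Y1] would be even. *)
move: oX oY le1 le3 leX leY; clear; lia.
Qed.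

(** Both [A] and [B] have parity opposite to [M]. If they differed, [opposite_parity_path] would
    give a path [Z] inside their union with the parity of [M], and [M] with [Z] would form a short
    even cycle. *)
Lemma theta_unique x q M A B :
    path e x (rcons M q) -> path e x (rcons A q) -> path e x (rcons B q) ->
    uniq (x :: rcons M q) -> uniq (x :: rcons A q) -> uniq (x :: rcons B q) ->
    ~~ has [in M] A -> ~~ has [in M] B -> 0 < size A -> 0 < size B ->
    size A + size B + 2 <= 2 * k -> size M + size A + 2 <= 2 * k ->
    size M + size B + 2 <= 2 * k ->
  A = B.
Proof.
move=> pM pA pB uM uA uB dA dB A0 B0 leAB leA leB.
have oA : odd (size M + size A).
  by apply: (odd_internally_disjoint pM pA) => //; rewrite ltn_addl.
have oB : odd (size M + size B).
  by apply: (odd_internally_disjoint pM pB) => //; rewrite ltn_addl.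
apply/eqP/negPn/negP => /eqP neqAB.
have [|||| Z [[pZ uZ lZ] [oZ ltZ sZ hZ]]] := opposite_parity_path pA pB uA uB.
- by rewrite !last_rcons.
- by move: leAB; rewrite !size_rcons; clear; lia.
- by move: oA oB; rewrite !size_rcons; clear; lia.
- by move/rcons_inj=> [].
move: lZ; rewrite last_rcons => lZ.
case/lastP: Z => [|Z z] in pZ uZ lZ oZ ltZ sZ hZ.
  by move: uA; rewrite /= mem_rcons -lZ mem_head.
move: lZ; rewrite last_rcons => zq; rewrite {z}zq in pZ uZ oZ ltZ sZ hZ.
have dZ : ~~ has [in M] Z.
  apply/hasPn=> z zZ; move: (uZ); rewrite /= rcons_uniq => /and3P[_ qZ _].
  have zq : z != q by apply: contraNneq qZ => <-.
  have /sZ : z \in rcons Z q by rewrite mem_rcons inE zZ orbT.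
  rewrite mem_cat !mem_rcons !inE (negPf zq) /= => /orP[zA|zB].
    exact: (hasPn dA).
  exact: (hasPn dB).
(* The path through [Z] starts with the first vertex of [A] or of [B], which is not [q]. This
   matters when [M] is empty. *)
have Z0 : 0 < size Z.
  case: (Z) hZ => //; rewrite /= !inE.
  move: uA uB; rewrite /= !rcons_uniq => /and3P[_ qA _] /and3P[_ qB _].
  case: (A) A0 qA => // a A' _; case: (B) B0 qB => // b B' _ /=.
  by rewrite !inE !negb_or => /andP[/negPf-> _] /andP[/negPf-> _].
have oZM : odd (size M + size Z).
  apply: (odd_internally_disjoint pM pZ) => //; first by rewrite ltn_addl.
  by move: ltZ leA leB; rewrite !size_rcons; clear; lia.
by move: oA oZ oZM; rewrite !size_rcons; clear; lia.
Qed.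

(* Used with K = k - n: an ear is at most K longer than the segment it replaces,
   which keeps the closed walk formed by two ears within 2k edges. *)
Lemma ear_unique K x q D M Y q' D' M' Y' :
    M ++ q :: Y = M' ++ q' :: Y' ->
    path e x (M ++ q :: Y) -> uniq (x :: M ++ q :: Y) ->
    path e x (rcons D q) -> uniq (x :: rcons D q) ->
    path e x (rcons D' q') -> uniq (x :: rcons D' q') ->
    ~~ has [in M ++ q :: Y] D -> ~~ has [in M' ++ q' :: Y'] D' ->
    size M < size D <= size M + K -> size M' < size D' <= size M' + K ->
    size (M ++ q :: Y) + K <= k ->
  [/\ D = D', q = q' & Y = Y'].
Proof.
wlog leM : q D M Y q' D' M' Y' / size M <= size M'.
  move=> IH EM pM uM pD uD pD' uD' dD dD' szD szD' leK.
  case: (leqP (size M) (size M')) => [|/ltnW] leM.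
    exact: (IH q D M Y q' D' M' Y').
  rewrite EM in pM uM leK.
  by have [-> -> ->] := IH q' D' M' Y' q D M Y leM (esym EM) pM uM pD' uD' pD uD
    dD' dD szD' szD leK.
move=> EM pM uM pD uD pD' uD' dD dD' /andP[szD leD] /andP[szD' leD'] leK.
have pMq : path e x (rcons M q).
  by move: pM; rewrite -cat_rcons cat_path => /andP[].
have uMq : uniq (x :: rcons M q).
  by move: uM; rewrite -cat_rcons -cat_cons cat_uniq => /andP[].
have dDM : ~~ has [in M] D.
  apply: contra dD => /hasP[z zD zM]; apply/hasP; exists z => //=.
  by rewrite mem_cat zM.
have dDM' : ~~ has [in M] D'.
  rewrite -EM in dD'.
  apply: contra dD' => /hasP[z zD zM]; apply/hasP; exists z => //=.
  by rewrite mem_cat zM.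
(* If both ears end at the same vertex, [theta_unique] applies to them and [M]. *)
have [EsM|ltM] : size M = size M' \/ size M < size M'.
  by move: leM; clear; lia.
  have /andP[/eqP EM1 /eqP[Eq EY]] : (M == M') && (q :: Y == q' :: Y').
    by rewrite -eqseq_cat // EM.
  rewrite -Eq in pD' uD' *; split=> //.
  move: leK; rewrite size_cat /= => leK.
  by apply: (theta_unique pMq pD pD') => //;
    move: EsM szD leD szD' leD' leK; clear; lia.
have [N EN] : exists N, M' = M ++ q :: N.
  exists (drop (size M).+1 M'); rewrite -{1}(cat_take_drop (size M).+1 M').
  rewrite -cat_rcons; congr (_ ++ _).
  have := congr1 (take (size M).+1) EM.
  rewrite -cat_rcons take_size_cat ?size_rcons // take_cat.
  case: ltnP => [_ ->//|le ->]; have -> : (size M).+1 = size M'.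
    by apply/eqP; rewrite eqn_leq ltM.
  by rewrite subnn take0 cats0 take_size.
have EY : Y = N ++ q' :: Y'.
  by move: EM; rewrite EN -catA => /eqP; rewrite eqseq_cat // eqxx => /eqP[].
have szM' : size M' = (size M + size N).+1 by rewrite EN size_cat /= addnS.
rewrite EY in leK uM pM dD; rewrite -EM EY in dD'.
(* Follow [D'] to [q'], then go back to [q] through [N]. By [theta_unique] this path is [D], which
   then meets [Y] at [q'], against [dD]. *)
have pB : path e x (rcons (D' ++ q' :: rev N) q).
  rewrite -cat_rcons rcons_cat cat_path pD' last_rcons.
  have := rev_path e q (rcons N q').
  rewrite last_rcons belast_rcons rev_cons => ->.
  rewrite (eq_path (e' := e)); last by move=> a b; rewrite /= e_sym.
  move: pM; rewrite -cat_rcons cat_path last_rcons -cat_rcons cat_path.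
  by case/and3P.
have uB : uniq (x :: rcons (D' ++ q' :: rev N) q).
  move: uM; rewrite cons_uniq cat_uniq cons_uniq cat_uniq.
  rewrite !(mem_cat, inE) !negb_or => /andP[/and5P[_ xq xN xq' _]].
  case/and4P=> _ _ /and3P[qN qq' _] /and3P[uN].
  case/andP=> q'N _ _.
  move: uD'; rewrite /= !rcons_uniq mem_rcons inE negb_or.
  case/and3P=> /andP[_ xD'] q'D' uD'.
  rewrite mem_rcons inE negb_or xq mem_cat inE mem_rev !negb_or xD' xq' xN /=.
  rewrite mem_cat inE mem_rev !negb_or qq' qN cat_uniq /= uD' mem_rev q'N.
  rewrite rev_uniq uN negb_or q'D' !andbT /=; apply/andP; split.
    apply: contra dD' => qD'; apply/hasP; exists q => //=.
    by rewrite mem_cat mem_head orbT.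
  apply: contra dD' => /hasP[z]; rewrite mem_rev => zN zD'.
  by apply/hasP; exists z => //=; rewrite mem_cat inE mem_cat zN !orbT.
have dBM : ~~ has [in M] (D' ++ q' :: rev N).
  rewrite has_cat negb_or dDM' /=.
  move: uM; rewrite /= cat_uniq /= => /and4P[_ _ /norP[_ dM] _].
  apply: contra dM => /orP[q'M|/hasP[z zN zM]]; apply/hasP.
    by exists q' => //; rewrite mem_cat mem_head orbT.
  by exists z => //; move: zN; rewrite mem_rev mem_cat => ->.
have EDB : D = D' ++ q' :: rev N.
  have szB : size (D' ++ q' :: rev N) = size D' + (size N).+1.
    by rewrite size_cat /= size_rev.
  (* The two excesses of at most [K] give a total of at most [2 * (size M + size N + 2 + K)], which
     [leK] bounds by [2 * k]. *)
  move: leK; rewrite !size_cat /= size_cat /= => leK.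
  by apply: (theta_unique pMq pD pB) => //; rewrite ?szB;
    move: szM' szD leD szD' leD' leK; clear; lia.
case/negP: dD; apply/hasP; exists q'; first by rewrite EDB mem_cat mem_head orbT.
by rewrite /= mem_cat inE mem_cat mem_head !orbT.
Qed.

(** * Geodesics and ear decompositions *)

(** Minimality is over all walks, so a shortcut can be compared with [Y] without checking that its
    vertices are distinct. *)
Definition geodesic x Y :=
  path e x Y /\
  forall Z, path e x Z -> last x Z = last x Y -> size Y <= size Z.

Lemma geodesic_uniq x Y : geodesic x Y -> uniq (x :: Y).
Proof.
case=> pY minY.
have [Y' [pY' uY' lY' sY']] : exists Y',
    [/\ path e x Y', uniq (x :: Y'), last x Y' = last x Y & {subset Y' <= Y}].
  by case: (shortenP pY) => Y'; exists Y'.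
have sub : {subset x :: Y' <= x :: Y}.
  by move=> z; rewrite !inE => /predU1P[->|/sY' ->]; rewrite ?eqxx ?orbT.
by apply: (leq_size_uniq uY' sub); rewrite ltnS minY.
Qed.

Lemma geodesic_suffix x M q Y : geodesic x (M ++ q :: Y) -> geodesic q Y.
Proof.
rewrite -cat_rcons => -[]; rewrite cat_path last_rcons => /andP[pM pY] minY.
split=> // Z pZ lZ.
have := minY (rcons M q ++ Z); rewrite cat_path pM !last_cat !last_rcons pZ lZ.
by rewrite !size_cat leq_add2l => ->.
Qed.

(* In [ear_decomp x X Y B], the sequences X and Y are those of two paths starting
   at x and B lists the vertices where X leaves Y.  An ear D need only avoid the
   part of Y not yet traversed. *)
Inductive ear_decomp : T -> seq T -> seq T -> seq T -> Prop :=
| EarNil x : ear_decomp x [::] [::] [::]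
| EarFollow x y X Y B :
    ear_decomp y X Y B -> ear_decomp x (y :: X) (y :: Y) B
| EarDetour x q D X M Y B :
    ~~ has [in M ++ q :: Y] D -> size M < size D ->
    ear_decomp q X Y B -> ear_decomp x (D ++ q :: X) (M ++ q :: Y) (x :: B).

(** Each ear is longer by at least one than the segment it replaces. For lengths [k] and [n] this
    leaves at most [k - n] ears. *)
Lemma ear_decomp_size x X Y B :
  ear_decomp x X Y B -> size Y + size B <= size X.
Proof.
elim=> {x X Y B} [//|x y X Y B _ /= IH|x q D X M Y B _ ltMD _ IH].
  by rewrite addSn ltnS.
by move: ltMD IH; rewrite !size_cat /=; clear; lia.
Qed.

Lemma ear_decomp_sub x X Y B :
  ear_decomp x X Y B -> {subset B <= belast x Y}.
Proof.
elim=> {x X Y B} [//|x y X Y B _ IH|x q D X M Y B _ _ _ IH] z.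
  by move/IH; rewrite /= inE => ->; rewrite orbT.
rewrite -cat_rcons belast_cat belast_rcons last_rcons /= !inE mem_cat.
by case/predU1P=> [->|/IH ->]; rewrite ?eqxx ?orbT.
Qed.

(** Cut both paths at the first vertex [q] of [X] on [Y]. Since [Y] is geodesic, the piece [D] is no
    shorter than [M], and the odd cycle they form excludes equality. *)
Lemma ear_decomp_exists x X Y :
    path e x X -> uniq (x :: X) -> last x X = last x Y -> geodesic x Y ->
    size X + size Y <= 2 * k ->
  exists B, ear_decomp x X Y B.
Proof.
have [n] := ubnP (size X); elim: n => // n IHn in x X Y *.
move=> ltX pX uX El gY le; have uY := geodesic_uniq gY.
case: X => [|a X] in ltX pX uX El le *.
  case: Y => [|b Y] in El gY le uY *; first by exists [::]; apply: EarNil.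
  have Ex : x = last b Y := El.
  by move: uY; rewrite /= {1}Ex mem_last.
case: Y => [|b Y] in El gY le uY *.
  have Ex : x = last a X := esym El.
  by move: uX; rewrite /= {1}Ex mem_last.
have [Eab|neq_ab] := eqVneq a b.
  rewrite -{b}Eab in El gY le uY *.
  move: pX uX => /= /andP[_ pX] /andP[_ uX].
  have [||B dB] := IHn a X Y _ pX uX El (@geodesic_suffix x [::] a Y gY).
  - by move: ltX => /=; clear; lia.
  - by move: le => /=; clear; lia.
  by exists B; apply: EarFollow.
have /has_split_first[D [q [X2 [EX qY dX]]]] : has [in b :: Y] (a :: X).
  apply/hasP; exists (last a X); first exact: mem_last.
  by rewrite [last a X]El; exact: (mem_last b Y).
have [M [Y2 EY]] := mem_split qY.
have neqDM : 0 < size D + size M.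
  rewrite lt0n addn_eq0; apply/negP=> /andP[/nilP D0 /nilP M0].
  by move: EX EY; rewrite D0 M0 => -[Ea _] [Eb _]; rewrite Ea Eb eqxx in neq_ab.
move: ltX pX uX El gY le uY dX; rewrite EX EY -!cat_rcons !last_cat !last_rcons.
rewrite !size_cat !size_rcons => ltX pX uX El gY le uY dX.
move: (pX); rewrite cat_path last_rcons => /andP[pD pX2].
move: (gY.1); rewrite cat_path last_rcons => /andP[pM pY2].
have leMD : size M <= size D.
  have := gY.2 (rcons D q ++ Y2); rewrite cat_path pD !last_cat !last_rcons pY2.
  by rewrite !size_cat !size_rcons leq_add2r ltnS; apply.
have oDM : odd (size D + size M).
  apply: (odd_internally_disjoint pD pM) => //.
  - by move: uX; rewrite -cat_cons cat_uniq => /andP[].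
  - by move: uY; rewrite -cat_cons cat_uniq => /andP[].
  - apply: contra dX => /hasP[z zM zD]; apply/hasP; exists z => //=.
    by rewrite mem_cat mem_rcons inE zM orbT.
  - by move: le; clear; lia.
rewrite !cat_rcons in gY dX *.
have [|||B dB] := IHn q X2 Y2 _ pX2 _ El (geodesic_suffix gY).
- by move: ltX; clear; lia.
- by move: uX; rewrite cat_rcons -cat_cons cat_uniq => /and3P[].
- by move: le; clear; lia.
by exists (x :: B); apply: EarDetour => //;
  move: leMD oDM; clear; lia.
Qed.

Lemma ear_decomp_inv x X Y B :
    ear_decomp x X Y B ->
  [\/ [/\ X = [::], Y = [::] & B = [::]],
      exists y X1 Y1, [/\ X = y :: X1, Y = y :: Y1 & ear_decomp y X1 Y1 B] |
      exists q D X1 M Y1 B1, [/\ X = D ++ q :: X1, Y = M ++ q :: Y1, B = x :: B1 &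
        [/\ ~~ has [in Y] D, size M < size D & ear_decomp q X1 Y1 B1]]].
Proof.
case=> {x X Y B} [x|x y X Y B dX|x q D X M Y B dD lt dX].
- by constructor 1.
- by constructor 2; exists y, X, Y.
- by constructor 3; exists q, D, X, M, Y, B.
Qed.

Lemma ear_decomp_sub_cons x X Y B :
  ear_decomp x X Y B -> {subset B <= x :: Y}.
Proof. by move=> dX z /(ear_decomp_sub dX); apply: mem_belast. Qed.

(** No ear starts in [x :: M], so [X] can only follow [Y] up to [q]. *)
Lemma ear_decomp_skip x X M q Y B :
    ear_decomp x X (M ++ q :: Y) B -> uniq (x :: M ++ q :: Y) ->
    {subset B <= q :: Y} ->
  exists2 X2, X = M ++ q :: X2 & ear_decomp q X2 Y B.
Proof.
elim: M x X => [|a M IH] x X dX uY sB;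
  case: (ear_decomp_inv dX) => [[_ //]|[y [X1 [Y1 [-> [<- <-] dX1]]]]|].
- by exists X1.
- move=> [? [? [? [? [? [B1 [_ _ EB _]]]]]]]; move: uY; rewrite cons_uniq.
  by rewrite /= -/(_ \in q :: Y) sB // EB mem_head.
- have [_ uY1] := andP uY.
  by have [X2 -> dX2] := IH _ _ dX1 uY1 sB; exists X2.
- move=> [? [? [? [? [? [B1 [_ _ EB _]]]]]]]; move: uY; rewrite cons_uniq.
  by rewrite mem_cat sB ?orbT // EB mem_head.
Qed.

(** Induction along [Y]. Where only [X'] leaves [Y], [X] follows [Y] to the end of that ear and is
    strictly shorter there; where both leave, [ear_unique] makes the ears equal. For paths of equal
    length this gives injectivity and the antichain property at once. *)
Lemma ear_decomp_mono K x X X' Y B B' :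
    ear_decomp x X Y B -> ear_decomp x X' Y B' ->
    path e x X -> uniq (x :: X) -> path e x X' -> uniq (x :: X') ->
    path e x Y -> uniq (x :: Y) ->
    size X <= size Y + K -> size X' <= size Y + K -> size Y + K <= k ->
    {subset B <= B'} ->
  X = X' \/ size X < size X'.
Proof.
have [n] := ubnP (size Y); elim: n => // n IHn in x X X' Y B B' *.
move=> ltY dX dX' pX uX pX' uX' pY uY leX leX' leK sB.
have xY : x \notin Y by case/andP: uY.
(* The piece cut from the path is at least as long as the one cut from [Y], so the excess stays at
   most [K]. *)
have tail M q Y1 Z1 D X1 : Y = M ++ q :: Y1 -> Z1 = D ++ q :: X1 ->
    path e x Z1 -> uniq (x :: Z1) -> size M <= size D -> size Z1 <= size Y + K ->
    [/\ path e q X1, uniq (q :: X1), size X1 <= size Y1 + K, path e x (rcons D q)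
       & uniq (x :: rcons D q)].
  move=> EY -> pZ uZ leMD leZ; split.
  - by move: pZ; rewrite -cat_rcons cat_path last_rcons => /andP[].
  - by move: uZ; rewrite -cat_cons cat_uniq => /and3P[].
  - by move: leZ leMD; rewrite EY !size_cat /=; clear; lia.
  - by move: pZ; rewrite -cat_rcons cat_path => /andP[].
  - by move: uZ; rewrite -cat_rcons -cat_cons cat_uniq => /and3P[].
have next M q Y1 : Y = M ++ q :: Y1 ->
    [/\ path e q Y1, uniq (q :: Y1), size Y1 < n & size Y1 + K <= k].
  move=> EY; split.
  - by move: pY; rewrite EY -cat_rcons cat_path last_rcons => /andP[].
  - by move: uY; rewrite EY -cat_cons cat_uniq => /and3P[].
  - by move: ltY; rewrite EY size_cat /=; clear; lia.
  - by move: leK; rewrite EY size_cat /=; clear; lia.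
case: (ear_decomp_inv dX') => [[EX' EY _]|[y [X1' [Y1 [EX' EY dX1']]]]|].
- case: (ear_decomp_inv dX) => [[-> _ _]|[y [X1 [Y1 [_]]]]|]; first by left.
    by rewrite EY.
  by case=> q [D [X1 [M [Y1 [B1 [_]]]]]]; rewrite EY; case: M.
(* When [X'] follows [Y], all of [B'] lies in [Y], which does not contain [x]; so [X] has no ear at
   [x] either. *)
- case: (ear_decomp_inv dX) => [[_]|[y1 [X1 [Y2 [EX EY2 dX1]]]]|]; first by rewrite EY.
    move: EY2; rewrite EY => -[Ey EY2]; rewrite -{y1}Ey -{Y2}EY2 in EX dX1.
    have [pY1 uY1 ltY1 leK1] := next [::] y Y1 EY.
    have [pX1 uX1 leX1 _ _] := tail [::] y Y1 X [::] X1 EY EX pX uX (leqnn _) leX.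
    have [pX1' uX1' leX1' _ _] :=
      tail [::] y Y1 X' [::] X1' EY EX' pX' uX' (leqnn _) leX'.
    have [E|lt] := IHn _ _ _ _ _ _ ltY1 dX1 dX1' pX1 uX1 pX1' uX1' pY1 uY1
      leX1 leX1' leK1 sB; [left | right]; rewrite EX EX' ?E //.
  case=> q [D [X1 [M [Y2 [B1 [_ _ EB _]]]]]]; case/negP: xY.
  rewrite EY; apply: (ear_decomp_sub_cons dX1'); apply: sB.
  by rewrite EB mem_head.
case=> q' [D' [X1' [M' [Y1' [B1' [EX' EY' EB' [dD' ltMD' dX1']]]]]]].
have [pY1 uY1 ltY1 leK1] := next M' q' Y1' EY'.
have [pX1' uX1' leX1' pD' uD'] :=
  tail M' q' Y1' X' D' X1' EY' EX' pX' uX' (ltnW ltMD') leX'.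
case: (boolP (x \in B)) => xB; last first.
  have sB1 : {subset B <= B1'}.
    move=> z zB; have := sB z zB; rewrite EB' inE => /predU1P[zx|//].
    by rewrite -zx zB in xB.
  have sBq : {subset B <= q' :: Y1'}.
    by move=> z /sB1; apply: ear_decomp_sub_cons dX1' z.
  rewrite EY' in dX uY.
  have [X1 EX dX1] := ear_decomp_skip dX uY sBq.
  have [pX1 uX1 leX1 _ _] := tail M' q' Y1' X M' X1 EY' EX pX uX (leqnn _) leX.
  have [E|lt] := IHn _ _ _ _ _ _ ltY1 dX1 dX1' pX1 uX1 pX1' uX1' pY1 uY1
    leX1 leX1' leK1 sB1; right; rewrite EX EX' !size_cat /= ?E.
    by move: ltMD'; clear; lia.
  by move: ltMD' lt; clear; lia.
case: (ear_decomp_inv dX) => [[_ _ EB]|[y [X1 [Y1 [EX EY dX1]]]]|].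
- by rewrite EB in xB.
- by case/negP: xY; rewrite EY; apply: (ear_decomp_sub_cons dX1).
case=> q [D [X1 [M [Y1 [B1 [EX EY EB [dD ltMD dX1]]]]]]].
have [pX1 uX1 leX1 pD uD] := tail M q Y1 X D X1 EY EX pX uX (ltnW ltMD) leX.
(* The rest of [X] is no shorter than the rest of [Y], so the ear by itself has excess at most
   [K]. *)
have leY : size Y1 <= size X1.
  by apply: leq_trans (ear_decomp_size dX1); apply: leq_addr.
have leY' : size Y1' <= size X1'.
  by apply: leq_trans (ear_decomp_size dX1'); apply: leq_addr.
have szD : size M < size D <= size M + K.
  by rewrite ltMD; move: leX leY; rewrite EX EY !size_cat /=; clear; lia.
have szD' : size M' < size D' <= size M' + K.
  by rewrite ltMD'; move: leX' leY'; rewrite EX' EY' !size_cat /=; clear; lia.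
have [ED Eq EY1] : [/\ D = D', q = q' & Y1 = Y1'].
  by apply: (@ear_unique K x q D M Y1 q' D' M' Y1') => //; rewrite -?EY -?EY' //.
rewrite -Eq in EX' dX1' uX1' pX1' pY1 uY1; rewrite -ED in EX'.
rewrite EY1 in dX1.
have sB1 : {subset B1 <= B1'}.
  move=> z zB; have := sB z; rewrite EB EB' !inE zB orbT => /(_ isT).
  case/predU1P=> [zx|//]; case/negP: xY; rewrite -zx EY mem_cat EY1.
  by rewrite (ear_decomp_sub_cons dX1 zB) orbT.
rewrite EY1 in leX1.
have [E|lt] := IHn _ _ _ _ _ _ ltY1 dX1 dX1' pX1 uX1 pX1' uX1' pY1 uY1
  leX1 leX1' leK1 sB1; [left | right]; rewrite EX EX' ?E //.
by move: lt; rewrite !size_cat /=; clear; lia.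
Qed.

End Graph.

(** * Counting the paths *)

Theorem theorem2 (k : nat) (T : finType) (e : rel T)
    (k_gt0 : 0 < k)
    (e_sym : symmetric e) (e_irr : irreflexive e)
    (no_short_even_cycle :
       ~ exists c : seq T,
           [/\ graph_cycle e c, ~~ odd (size c) & size c <= 2 * k])
    (u v : T) (u_neq_v : u != v) :
  #|upaths e k u v| <= \max_(r < k.+1) 'C(r, minn (r %/ 2) (k - r)).
Proof.
have [->|[p0 p0F]] := set_0Vmem (upaths e k u v); first by rewrite cards0.
(* The path [p0] witnesses a walk of length [k], so the least walk length [n] exists and is at most
   [k]. *)
have exw : exists n, [exists t : n.-tuple T, path e u t && (last u t == v)].
  exists k; apply/existsP; exists p0; move: p0F.
  by rewrite inE => /and3P[-> _ ->].
have [n /existsP[Yt /andP[pY /eqP lY]] min_n] := ex_minnP exw.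
set Y : seq T := tval Yt in pY lY; have szY : size Y = n := size_tuple Yt.
have gY : geodesic e u Y.
  split=> // Z pZ lZ; rewrite szY; apply: min_n; apply/existsP.
  by exists (in_tuple Z); rewrite /= pZ lZ lY eqxx.
have uY := geodesic_uniq gY.
have n_le_k : n <= k.
  by apply: min_n; apply/existsP; exists p0; move: p0F; rewrite inE => /and3P[-> _ ->].
have /fin_all_exists[f Hf] (p : k.-tuple T) :
    exists B, p \in upaths e k u v -> ear_decomp u p Y B.
  case: (boolP (p \in upaths e k u v)) => [|_]; last by exists [::].
  rewrite inE => /and3P[pp up /eqP lp].
  have [||B dB] := ear_decomp_exists e_sym no_short_even_cycle pp up _ gY.
  - by rewrite lp lY.
  - by rewrite size_tuple szY mul2n -addnn leq_add2l.
  by exists B.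
pose g p := [set x in f p].
have g_sub p q : p \in upaths e k u v -> q \in upaths e k u v ->
    g p \subset g q -> p = q.
  move=> pF qF /subsetP sg; move: (pF) (qF); rewrite !inE.
  case/and3P=> pp up _ /and3P[pq uq _]; apply: val_inj => /=.
  have [||||//|] := ear_decomp_mono e_sym no_short_even_cycle (K := k - n)
    (Hf p pF) (Hf q qF) pp up pq uq pY uY.
  - by rewrite size_tuple szY subnKC.
  - by rewrite size_tuple szY subnKC.
  - by rewrite szY subnKC.
  - by move=> z; have := sg z; rewrite !inE.
  by rewrite !size_tuple ltnn.
(* Ears start at vertices of the geodesic other than [v]. *)
have cardD : #|[set x in belast u Y]| = n.
  rewrite cardsE -szY -(size_belast u Y); apply/card_uniqP.
  by move: uY; rewrite lastI rcons_uniq => /andP[].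
have <- : #|g @: upaths e k u v| = #|upaths e k u v|.
  by apply: card_in_imset => p q pF qF E; apply: g_sub => //; rewrite E.
(* The index [r] of the maximum is the distance [n] from [u] to [v]. *)
apply: leq_trans (leq_bigmax (Ordinal (n_le_k : n < k.+1))) => /=.
rewrite -{1 2}cardD; apply: card_antichain_le.
- move=> A /imsetP[p pF ->]; apply/subsetP=> z; rewrite !inE.
  exact: ear_decomp_sub (Hf p pF) z.
- move=> A B /imsetP[p pF ->] /imsetP[q qF ->] sAB.
  by rewrite (g_sub p q).
- move=> A /imsetP[p pF ->]; have := ear_decomp_size (Hf p pF).
  rewrite size_tuple szY -leq_subRL // => le.
  by apply: leq_trans le; rewrite /g cardsE; apply: card_size.
Qed.
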